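(* Let $\boldsymbol\beta_3=(\beta_0,\beta_1,\beta_2,\beta_3)$ with $\beta_k\ge0$ and let $\mathbf{W}=(W,\mathbb{W})\in\mathbf{C}^{\alpha,\boldsymbol\beta_3}([0,T]\times V;V)$ be a nonlinear rough path. For any time interval $[0,T]$ and initial value $\xi\in V$, there exists at most one solution on $[0,T]$ to the rough differential equation $$Y_t=\xi+\int_0^tW(dr,Y_r).$$
   Context: Here $T>0$, $\alpha\in(\frac13,\frac12]$ and $V$ is a separable Banach space. For a function $\Phi$ of time, $\Phi_{s,t}:=\Phi_t-\Phi_s$ (for $W(t,x)$: $W_{s,t}(x)=W(t,x)-W(s,x)$). $\mathcal{C}^\alpha([0,T];V)$ is the space of $Y:[0,T]\to V$ with $\|Y\|_\alpha=\sup_{s\ne t}\|Y_{s,t}\|_V/|t-s|^\alpha<\infty$; $\mathcal{C}_2^{2\alpha}([0,T]^2;V)$ is the space of $R:[0,T]^2\to V$ with $\sup_{s\ne t}\|R_{s,t}\|_V/|t-s|^{2\alpha}<\infty$. For $\boldsymbol\beta_n=(\beta_0,\dots,\beta_n)$ with $\beta_k\ge0$, $\mathcal{C}^{\alpha,\boldsymbol\beta_n}([0,T]\times V;V)$ is the space of functions $\Phi$, $n$ times continuously Fréchet differentiable in space, with $$\|\Phi\|_{\alpha,\boldsymbol\beta_n}=\sum_{k=0}^n\sup_{s\ne t,\,x\in V}\frac{\|D^k\Phi_{s,t}(x)\|}{|t-s|^\alpha(1+\|x\|_V)^{\beta_k}}<\infty .$$ For multi-indices $\boldsymbol\beta^1,\boldsymbol\beta^2$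 of length $m+1$ and $\gamma>0$, $\mathcal{C}_2^{\gamma,\boldsymbol\beta^1,\boldsymbol\beta^2}([0,T]^2\times V^2;V)$ is the space of $\Psi$, $m$ times continuously Fréchet differentiable in $(x_1,x_2)\in V^2$ (normed by $\|x_1\|_V+\|x_2\|_V$), with $$\|\Psi\|_{\gamma,\boldsymbol\beta^1,\boldsymbol\beta^2}=\sum_{k=0}^m\sup_{s\ne t,\,(x_1,x_2)\in V^2}\frac{\|D^k\Psi_{s,t}(x_1,x_2)\|}{|t-s|^\gamma(1+\|x_1\|_V)^{\beta^1_k}(1+\|x_2\|_V)^{\beta^2_k}}<\infty .$$ Given $\boldsymbol\beta_n$, $n\ge1$, set $\beta^*_k=\max\{\beta_0,\dots,\beta_k\}$, $\beta^{**}_k=\max\{\beta_1,\dots,\beta_{k+1}\}$ for $0\le k\le n-1$, $\boldsymbol\beta^*_{n-1}=(\beta^*_0,\dots,\beta^*_{n-1})$, $\boldsymbol\beta^{**}_{n-1}=(\beta^{**}_0,\dots,\beta^{**}_{n-1})$. A nonlinear rough path $\mathbf{W}=(W,\mathbb{W})\in\mathbf{C}^{\alpha,\boldsymbol\beta_n}([0,T]\times V;V)$ is a pair with $W\in\mathcal{C}^{\alpha,\boldsymbol\beta_n}([0,T]\times V;V)$, $\mathbb{W}\in\mathcal{C}_2^{2\alpha,\boldsymbol\beta^*_{n-1},\boldsymbol\beta^{**}_{n-1}}([0,T]^2\times V^2;V)$, satisfying Chen's relation $\mathbb{W}_{s,t}(x,y)-\mathbb{W}_{s,u}(x,y)-\mathbb{W}_{u,t}(x,y)=DW_{u,t}(y)(W_{s,u}(x))$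 for all $x,y\in V$, $s,u,t\in[0,T]$. $\mathcal{E}_W^{2\alpha}$ is the set of pairs $(Y,\dot Y)\in\mathcal{C}^\alpha([0,T];V)^2$ such that $R^Y_{s,t}:=Y_{s,t}-W_{s,t}(\dot Y_s)$ belongs to $\mathcal{C}_2^{2\alpha}([0,T]^2;V)$. For such a pair the nonlinear rough integral is $$\int_s^tW(dr,Y_r):=\lim_{|\pi|\to0}\sum_{k=1}^n\big[W_{t_{k-1},t_k}(Y_{t_{k-1}})+\mathbb{W}_{t_{k-1},t_k}(\dot Y_{t_{k-1}},Y_{t_{k-1}})\big]$$ over partitions $\pi=(s=t_0<\dots<t_n=t)$ of mesh $|\pi|\to0$ (the limit exists). A solution on $[0,T]$ is an $\alpha$-Hölder continuous $Y:[0,T]\to V$ with $Y_0=\xi$, such that $(Y,Y)\in\mathcal{E}^{2\alpha}_W$ and the equation holds for all $t\in[0,T]$, the integral being the nonlinear rough integral with $\dot Y=Y$. *)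

(* Defs.v *)
From HB Require Import structures.
From mathcomp Require Import all_boot all_order all_algebra.
From mathcomp Require Import all_classical all_reals all_analysis.

Set Implicit Arguments.
Unset Strict Implicit.
Unset Printing Implicit Defensive.

Import Order.TTheory GRing.Theory Num.Theory.
Import numFieldNormedType.Exports.
Local Open Scope classical_set_scope.
Local Open Scope ring_scope.

Section ContinuousLinear.
Context {R : realType} (U V : normedModType R).

Definition clinear_pred : {pred U -> V} :=
  fun f => `[< linear f /\ continuous f >].

Record clin := Clin {
  clin_fun :> U -> V;
  clin_funP : clin_fun \in clinear_pred }.

HB.instance Definition _ := [isSub for clin_fun].
HB.instance Definition _ := [Choice of clin by <:].

Lemma clinear_predP (f : U -> V) :
  reflect (linear f /\ continuous f) (f \in clinear_pred).
Proof. by rewrite unfold_in; exact: asboolP. Qed.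

Lemma clinear_submod_closed : submod_closed clinear_pred.
Proof.
split.
  apply/clinear_predP; split; last by move=> x; exact: cvg_cst.
  by move=> a x y /=; rewrite scaler0 addr0.
move=> a f g /clinear_predP[lf cf] /clinear_predP[lg cg].
apply/clinear_predP; split.
  move=> b x y; rewrite !fctE lf lg !scalerDr !scalerA (mulrC a b).
  by rewrite addrACA.
by move=> x; apply: cvgD; [apply: cvgZl_tmp; exact: cf|exact: cg].
Qed.

HB.instance Definition _ := GRing.isSubmodClosed.Build R (U -> V)
  clinear_pred clinear_submod_closed.
HB.instance Definition _ := [SubChoice_isSubLmodule of clin by <:].

Lemma clin_linear (f : clin) : linear f.
Proof. by have /clinear_predP[] := clin_funP f. Qed.

Lemma clin_continuous (f : clin) : continuous f.
Proof. by have /clinear_predP[] := clin_funP f. Qed.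

Definition op_norm (f : clin) : R :=
  sup [set `|f h| | h in [set h : U | `|h| <= 1]].

Lemma op_norm_has_sup (f : clin) :
  has_sup [set `|f h| | h in [set h : U | `|h| <= 1]].
Proof.
split; first by exists `|f 0|, 0 => //=; rewrite normr0.
pose g := HB.pack_for {linear U -> V} (f : U -> V)
  (GRing.isLinear.Build R U V _ (f : U -> V) (clin_linear f)).
have /linear_bounded_continuous/bounded_funP/(_ 1)[M fM] :
  continuous g by exact: clin_continuous.
by exists M => _ [h /= h1 <-]; exact: fM.
Qed.

Lemma op_norm_ub (f : clin) (h : U) : `|h| <= 1 -> `|f h| <= op_norm f.
Proof.
by move=> h1; apply: ub_le_sup; [case: (op_norm_has_sup f)|exists h].
Qed.

Lemma op_norm_le (f : clin) (M : R) :
  (forall h, `|h| <= 1 -> `|f h| <= M) -> op_norm f <= M.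
Proof.
move=> fM; apply: ge_sup; first by case: (op_norm_has_sup f).
by move=> _ [h /= h1 <-]; exact: fM.
Qed.

Lemma op_norm_ge0 (f : clin) : 0 <= op_norm f.
Proof. by rewrite (le_trans (normr_ge0 (f 0)))// op_norm_ub// normr0. Qed.

Lemma ler_op_normD (f g : clin) : op_norm (f + g) <= op_norm f + op_norm g.
Proof.
apply: op_norm_le => h h1.
by rewrite (le_trans (ler_normD _ _))// lerD// op_norm_ub.
Qed.

Lemma op_normZ (a : R) (f : clin) : op_norm (a *: f) = `|a| * op_norm f.
Proof.
have le b g : op_norm (b *: g) <= `|b| * op_norm g.
  by apply: op_norm_le => h h1; rewrite normrZ ler_wpM2l// op_norm_ub.
apply/eqP; rewrite eq_le le/=; have [->|a0] := eqVneq a 0.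
  by rewrite normr0 mul0r op_norm_ge0.
rewrite -ler_pdivlMl ?normr_gt0// -normfV.
by rewrite (le_trans _ (le _ _))// scalerA mulVf// scale1r.
Qed.

Lemma op_norm_mul (f : clin) (h : U) : `|f h| <= op_norm f * `|h|.
Proof.
have f0 : f 0 = 0.
  by have := clin_linear f (-1) 0 0; rewrite scaler0 addr0 scaleN1r addNr.
have fZ a x : f (a *: x) = a *: f x.
  by have := clin_linear f a x 0; rewrite f0 !addr0.
have [->|h0] := eqVneq h 0; first by rewrite f0 !normr0 mulr0.
rewrite -ler_pdivrMr ?normr_gt0// mulrC.
rewrite -[X in X * _]ger0_norm ?invr_ge0// -normrZ -fZ op_norm_ub//.
by rewrite normfZV.
Qed.

Lemma op_norm_eq0 (f : clin) : op_norm f = 0 -> f = 0.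
Proof.
move=> f0; apply/val_inj/funext => h /=.
by apply/eqP; rewrite -normr_le0 (le_trans (op_norm_mul f h))// f0 mul0r.
Qed.

HB.instance Definition _ := Lmodule_isNormed.Build R clin
  ler_op_normD op_normZ op_norm_eq0.

(* [f] itself when it is continuous linear, and [0] otherwise *)
Definition to_clin (f : U -> V) : clin := insubd (0 : clin) f.

Lemma to_clinE (f : U -> V) :
  linear f -> continuous f -> to_clin f = f :> (U -> V).
Proof. by move=> lf cf; apply/insubdK/clinear_predP. Qed.

End ContinuousLinear.

Section HigherDerivatives.
Context {R : realType} {U V : normedModType R}.

(* The k-linear continuous maps, curried as L(U, L(U, ... L(U, V))) with the
   iterated operator norm, which is the usual norm of multilinear maps. *)
Fixpoint mlin (U V : normedModType R) (k : nat) : normedModType R :=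
  if k is k'.+1 then clin U (mlin U V k') else V.

Fixpoint Dn (k : nat) (f : U -> V) : U -> mlin U V k :=
  if k is k'.+1 then fun x => to_clin ('d (Dn k' f) x) else f.

Definition Cn (n : nat) (f : U -> V) : Prop :=
  (forall k, (k < n)%N -> forall x, differentiable (Dn k f) x) /\
  continuous (Dn n f).

Lemma DnSE k (f : U -> V) x : differentiable (Dn k f) x ->
  Dn k.+1 f x = 'd (Dn k f) x :> (U -> mlin U V k).
Proof.
move=> df; apply: to_clinE; last exact: diff_continuous.
by move=> a u v; exact: linearP.
Qed.

End HigherDerivatives.

(* The product with the norm |x1| + |x2|; the norm on [U * V] is the max. *)
Definition l1prod (U V : Type) : Type := (U * V)%type.

Section L1Product.
Context {R : realType} (U V : normedModType R).

HB.instance Definition _ := GRing.Lmodule.copy (l1prod U V) (U * V)%type.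

Definition l1norm (p : l1prod U V) : R := `|p.1| + `|p.2|.

Lemma ler_l1normD (p q : l1prod U V) : l1norm (p + q) <= l1norm p + l1norm q.
Proof. by rewrite /l1norm addrACA lerD// ler_normD. Qed.

Lemma l1normZ (a : R) (p : l1prod U V) : l1norm (a *: p) = `|a| * l1norm p.
Proof. by rewrite /l1norm !normrZ mulrDr. Qed.

Lemma l1norm_eq0 (p : l1prod U V) : l1norm p = 0 -> p = 0.
Proof.
move/eqP; rewrite paddr_eq0// !normr_eq0.
by case: p => p1 p2 /= /andP[/eqP -> /eqP ->].
Qed.

HB.instance Definition _ := Lmodule_isNormed.Build R (l1prod U V)
  ler_l1normD l1normZ l1norm_eq0.

End L1Product.

Definition separable (X : topologicalType) : Prop :=
  exists2 D : set X, countable D & dense D.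

Definition incr {R : realType} {E : zmodType} (F : R -> E) (s t : R) : E :=
  F t - F s.

Section Spaces.
Context {R : realType} {V : normedModType R}.
Variable T : R.

(* Functions of time are total; only their values on [0, T] matter. *)

Definition holder_norm2 (gamma : R) (A : R -> R -> V) : \bar R :=
  ereal_sup [set z | exists s t : R,
    [/\ s \in `[0, T], t \in `[0, T], s != t &
        z = (`|A s t| / `|t - s| `^ gamma)%:E]].

Definition C2_space (gamma : R) (A : R -> R -> V) : Prop :=
  (holder_norm2 gamma A < +oo)%E.

Definition holder_space (alpha : R) (Y : R -> V) : Prop :=
  C2_space alpha (incr Y).

Definition field_norm (alpha : R) n (beta : 'I_n.+1 -> R)
    (Phi : R -> V -> V) : \bar R :=
  (\sum_(k < n.+1) ereal_sup [set z | exists (s t : R) (x : V),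
    [/\ s \in `[0%R, T], t \in `[0%R, T], s != t &
        z = (`|Dn k (incr Phi s t) x| /
             (`|t - s| `^ alpha * (1 + `|x|) `^ beta k))%:E]])%E.

Definition field_space (alpha : R) n (beta : 'I_n.+1 -> R)
    (Phi : R -> V -> V) : Prop :=
  (forall t, t \in `[0, T] -> Cn n (Phi t)) /\
  (field_norm alpha beta Phi < +oo)%E.

Definition on_l1prod (F : V -> V -> V) (p : l1prod V V) : V := F p.1 p.2.

Definition field2_norm (gamma : R) m (beta1 beta2 : 'I_m.+1 -> R)
    (Psi : R -> R -> V -> V -> V) : \bar R :=
  (\sum_(k < m.+1) ereal_sup [set z | exists (s t : R) (p : l1prod V V),
    [/\ s \in `[0%R, T], t \in `[0%R, T], s != t &
        z = (`|Dn k (on_l1prod (Psi s t)) p| /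
             (`|t - s| `^ gamma * (1 + `|p.1|) `^ beta1 k
                                * (1 + `|p.2|) `^ beta2 k))%:E]])%E.

Definition field2_space (gamma : R) m (beta1 beta2 : 'I_m.+1 -> R)
    (Psi : R -> R -> V -> V -> V) : Prop :=
  (forall s t, s \in `[0, T] -> t \in `[0, T] ->
     Cn m (on_l1prod (Psi s t))) /\
  (field2_norm gamma beta1 beta2 Psi < +oo)%E.

(* The default 0 of the maxima below is harmless: exponents are nonnegative. *)
Definition beta_star n (beta : 'I_n.+2 -> R) (k : 'I_n.+1) : R :=
  \big[Num.max/0]_(i < n.+2 | (i <= k)%N) beta i.

Definition beta_starstar n (beta : 'I_n.+2 -> R) (k : 'I_n.+1) : R :=
  \big[Num.max/0]_(i < n.+2 | (1 <= i <= k.+1)%N) beta i.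

Definition chen (W : R -> V -> V) (WW : R -> R -> V -> V -> V) : Prop :=
  forall (x y : V) (s u t : R),
    s \in `[0, T] -> u \in `[0, T] -> t \in `[0, T] ->
    WW s t x y - WW s u x y - WW u t x y
      = 'd (incr W u t) y (incr W s u x).

(* The exponents are indexed by 0..n+1, so that n+1 >= 1 is the order of
   differentiability of W and n that of WW. *)
Definition nl_rough_path (alpha : R) n (beta : 'I_n.+2 -> R)
    (W : R -> V -> V) (WW : R -> R -> V -> V -> V) : Prop :=
  [/\ field_space alpha beta W,
      field2_space (2 * alpha) (beta_star beta) (beta_starstar beta) WW &
      chen W WW].

Definition controlled (alpha : R) (W : R -> V -> V) (Y Yd : R -> V) : Prop :=
  [/\ holder_space alpha Y, holder_space alpha Yd &
      C2_space (2 * alpha) (fun s t => incr Y s t - incr W s t (Yd s))].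

End Spaces.

Section Integral.
Context {R : realType} {V : normedModType R}.

Definition mesh (s t : R) (p : seq R) : R :=
  let u := nth t (s :: p) in
  \big[Num.max/0]_(0 <= k < size p) (u k.+1 - u k).

Definition rough_sum (W : R -> V -> V) (WW : R -> R -> V -> V -> V)
    (Y Yd : R -> V) (s t : R) (p : seq R) : V :=
  let u := nth t (s :: p) in
  \sum_(0 <= k < size p)
     (incr W (u k) (u k.+1) (Y (u k)) +
      WW (u k) (u k.+1) (Yd (u k)) (Y (u k))).

(* I is the limit of the compensated Riemann sums as the mesh tends to 0 *)
Definition is_nl_rough_integral (W : R -> V -> V)
    (WW : R -> R -> V -> V -> V) (Y Yd : R -> V) (s t : R) (I : V) : Prop :=
  forall e : R, 0 < e -> exists2 d : R, 0 < d &
    forall p : seq R, itv_partition s t p -> mesh s t p < d ->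
      `|rough_sum W WW Y Yd s t p - I| < e.

Definition is_solution (T alpha : R) (W : R -> V -> V)
    (WW : R -> R -> V -> V -> V) (xi : V) (Y : R -> V) : Prop :=
  [/\ holder_space T alpha Y,
      Y 0 = xi,
      controlled T alpha W Y Y &
      forall t, t \in `[0, T] ->
        exists2 I : V, is_nl_rough_integral W WW Y Y 0 t I & Y t = xi + I].

End Integral.

(* Main.v *)
Require Import Defs.
From mathcomp Require Import all_boot all_order all_algebra.
From mathcomp Require Import all_classical all_reals all_analysis.
From mathcomp Require Import ring lra.
Import Order.TTheory GRing.Theory Num.Theory.
Import numFieldNormedType.Exports.
Local Open Scope classical_set_scope.
Local Open Scope ring_scope.

Set Implicit Arguments.
Unset Strict Implicit.

(** Two solutions [Y] and [Z] are compared on a short interval [[a, b]] at whose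
left end they agree.  A solution is approximated over [[s, t]] by the germ
[W_{s,t}(Y_s) + WW_{s,t}(Y_s, Y_s)], and its remainder is
[Y_{s,t} - W_{s,t}(Y_s)].  Measure the distance of the two solutions by the least
[K] that bounds both [Y_{s,t} - Z_{s,t}] by [K |t - s|^alpha] and the difference
of the remainders by [K |t - s|^(2 alpha)] ([rough_close]).

The failure of additivity of the germ at an intermediate time is, by Chen's
relation and up to sign, a first-order Taylor remainder of [W_{u,t}], plus [DW_{u,t}] applied to
the remainder of the solution, plus an increment of [WW_{u,t}] ([germ_defect]).
Each of these three terms depends on the solution in a Lipschitz way with respect
to the distance [K]; this is where three derivatives of [W] and two of [WW] are
used ([taylor_remainder_difference], [Dn_increment_difference]).  Hence the defects
for [Y] and [Z] differ by at most [C K |t - s|^(3 alpha)]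
([germ_defect_difference]).

As [3 alpha > 1], sewing applies to the difference of the two germs: its Riemann
sums along dyadic partitions stay within a constant times [K |t - s|^(3 alpha)] of
it ([sewing_bound]), and they converge to [Y_{s,t} - Z_{s,t}]
([rough_integral_dyadic]).  So
[Y_{s,t} - Z_{s,t}] is the difference of the germs up to an error
[C K |t - s|^(3 alpha)] ([solution_sewing]).  Since [Y_a = Z_a], the germs
themselves differ little, and every term carries a factor [(b - a)^alpha] compared
with what the distance allows; for [b - a] small the distance [K] can therefore be
replaced by [K / 2] ([rough_close_half]).  Iterating, it vanishes
([rough_close_eq]).  The admissible length of the interval depends only on the
bounds for [W], [WW] and the two solutions, so finitely many steps cover [[0, T]]
([rough_solution_unique]).

Solutions are bounded, so all fields may be restricted to a fixed ball, on which
the polynomial weights of their norms are absorbed in a constant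
([field_ball_bound], [field2_ball_bound]). *)

(** * The mean value inequality for curves in a normed space *)

Section MeanValue.
Context {R : realType}.

(** The slope [M + e], with [e > 0], leaves room for the error of the linear
approximation at [t]; no such bound with slope [M] holds in general. *)
Lemma derive_local_lipschitz (V : normedModType R) (phi : R -> V) (t M e : R) :
  derivable phi t 1 -> `|'D_1 phi t| <= M -> 0 < e ->
  exists2 d, 0 < d & forall s, `|s - t| < d ->
    `|phi s - phi t| <= (M + e) * `|s - t|.
Proof.
move=> dphi DM e0.
have /cvgrPdist_lt/(_ _ e0)[d /= d0 dP] := dphi.
exists d => // s std; have [->|st] := eqVneq s t.
  by rewrite !subrr !normr0 mulr0.
have st0 : s - t != 0 by rewrite subr_eq0.
have := dP (s - t); rewrite /= sub0r normrN => /(_ std st0).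
have -> : (s - t) *: (1 : R) + t = s by rewrite /GRing.scale /= mulr1 subrK.
rewrite -/(derive phi t 1) => /ltW h.
rewrite -ler_pdivrMr ?normr_gt0// mulrC -normfV -normrZ.
rewrite -[X in `|X|](subrK ('D_1 phi t)) (le_trans (ler_normD _ _))//.
by rewrite addrC lerD// distrC.
Qed.

(** A vector-valued curve has no intermediate point realizing its mean slope, so the
classical theorem for real functions does not apply.  Instead, fix [e > 0] and
follow the set of times [t] at which [phi t - phi 0] has norm at most [(M + e) t].
The local bound at its supremum shows first that the supremum is attained, then
that it can be exceeded unless it is [1]. *)
Lemma mean_value_ineq (V : normedModType R) (phi : R -> V) (M : R) :
  (forall t, 0 <= t <= 1 -> derivable phi t 1 /\ `|'D_1 phi t| <= M) ->
  `|phi 1 - phi 0| <= M.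
Proof.
move=> dphi; apply/ler_addgt0Pr => e e0.
pose S := [set t | 0 <= t <= 1 /\ `|phi t - phi 0| <= (M + e) * t].
have S0 : S 0 by split; rewrite ?lexx ?ler01// subrr normr0 mulr0.
have supS : has_sup S by split; [exists 0|exists 1 => t [/andP[]]].
have c0 : 0 <= sup S by apply: ub_le_sup => //; case: supS.
have c1 : sup S <= 1 by apply: ge_sup => [|t [/andP[]]//]; exists 0.
have c01 : 0 <= sup S <= 1 by rewrite c0.
have [dc Dc] := dphi (sup S) c01.
have [d d0 loc] := derive_local_lipschitz dc Dc e0.
have Sc : S (sup S).
  split => //.
  have [s [/andP[s0 s1] sS] scd] := sup_adherent d0 supS.
  have sc : s <= sup S by apply: ub_le_sup; [case: supS|split => //; rewrite s0].
  have := loc s; rewrite distrC ger0_norm ?subr_ge0//.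
  have -> : sup S - s < d by lra.
  move=> /(_ isT) lo.
  have := ler_distD (phi s) (phi (sup S)) (phi 0); rewrite distrC in lo.
  nra.
have [c1E|cn1] := eqVneq (sup S) 1; first by case: Sc; rewrite c1E mulr1.
have cl1 : sup S < 1 by rewrite lt_neqAle cn1.
pose s := Num.min 1 (sup S + d / 2).
have [s1 cs sd] : [/\ s <= 1, sup S < s & s - sup S < d].
  by rewrite /s; case: (leP 1 (sup S + d / 2)) => ?; split; lra.
have : S s.
  split; first by rewrite s1 (le_trans c0 (ltW cs)).
  have := loc s; rewrite ger0_norm ?subr_ge0 ?(ltW cs)// => /(_ sd) lo.
  have := ler_distD (phi (sup S)) (phi s) (phi 0).
  case: Sc; nra.
by move/(ub_le_sup (proj2 supS)); rewrite leNgt cs.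
Qed.

End MeanValue.

(** * Lipschitz estimates for increments and Taylor remainders *)

Section TaylorEstimates.
Context {R : realType} {U V : normedModType R}.

Lemma clinB (W : normedModType R) (A B : clin U W) (h : U) :
  (A - B) h = A h - B h.
Proof. by []. Qed.

Lemma clin_argB (W : normedModType R) (A : clin U W) (h l : U) :
  A (h - l) = A h - A l.
Proof. by rewrite addrC -scaleN1r (clin_linear A) scaleN1r addrC. Qed.

Lemma ler_clin (W : normedModType R) (A : clin U W) (h : U) (a : R) :
  `|A| <= a -> `|A h| <= a * `|h|.
Proof. by move=> Aa; rewrite (le_trans (op_norm_mul A h))// ler_wpM2r. Qed.

Lemma line_derive (W : normedModType R) (F : U -> W) (h y : U) (t : R) :
  differentiable F (t *: h + y) ->
  is_derive t 1 (fun s => F (s *: h + y)) ('d F (t *: h + y) h).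
Proof.
move=> dF; set x := t *: h + y.
have E : (fun s : R => s^-1 *: (((fun s => F (s *: h + y)) \o shift t) (s *: 1)
            - F (t *: h + y)))
       = (fun s => s^-1 *: ((F \o shift x) (s *: h) - F x)).
  apply/funext => s /=; rewrite /x addrA -scalerDl.
  by rewrite [s *: 1]mulr1.
split; first by rewrite /derivable E; exact: diff_derivable.
by rewrite /derive E -/(derive F x h) deriveE.
Qed.

Lemma norm_segment (r t : R) (h y : U) : 0 <= t <= 1 ->
  `|y| <= r -> `|h + y| <= r -> `|t *: h + y| <= r.
Proof.
move=> /andP[t0 t1] yr hyr.
have -> : t *: h + y = t *: (h + y) + (1 - t) *: y.
  by rewrite scalerDr -addrA -scalerDl addrCA subrr addr0 scale1r.
rewrite (le_trans (ler_normD _ _))// !normrZ !ger0_norm ?subr_ge0//.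
nra.
Qed.

Variables (f : U -> V) (r : R).

Lemma Dn_lipschitz k (L : R) (x y : U) :
  (forall z, differentiable (Dn k f) z) ->
  (forall z, `|z| <= r -> `|Dn k.+1 f z| <= L) ->
  `|x| <= r -> `|y| <= r -> `|Dn k f x - Dn k f y| <= L * `|x - y|.
Proof.
move=> df dL xr yr.
have := @mean_value_ineq R _ (fun t => Dn k f (t *: (x - y) + y)) (L * `|x - y|).
rewrite scale1r subrK scale0r add0r; apply => t t01.
have [dt ->] := line_derive (df (t *: (x - y) + y)).
split => //; rewrite -DnSE//; apply: ler_clin; apply: dL.
by apply: norm_segment => //; rewrite subrK.
Qed.

(** Comparison of two increments of [f].  The two segments are run through with the
same parameter, so that the derivative of the difference splits into a change of
the base point, controlled by the next derivative, and a change of the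
direction. *)
Lemma Dn_increment_difference k (L1 L2 : R) (y h z l : U) :
  (forall x, differentiable (Dn k f) x) ->
  (forall x, differentiable (Dn k.+1 f) x) ->
  (forall x, `|x| <= r -> `|Dn k.+1 f x| <= L1) ->
  (forall x, `|x| <= r -> `|Dn k.+2 f x| <= L2) ->
  `|y| <= r -> `|h + y| <= r -> `|z| <= r -> `|l + z| <= r ->
  `|(Dn k f (h + y) - Dn k f y) - (Dn k f (l + z) - Dn k f z)| <=
    L2 * (`|y - z| + `|h - l|) * `|h| + L1 * `|h - l|.
Proof.
move=> df df1 dL1 dL2 yr hyr zr lzr.
pose phi (t : R) := Dn k f (t *: h + y) - Dn k f (t *: l + z).
have -> : (Dn k f (h + y) - Dn k f y) - (Dn k f (l + z) - Dn k f z) =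
    phi 1 - phi 0.
  rewrite /phi !scale1r !scale0r !add0r !opprB addrACA [RHS]addrACA.
  by congr (_ + _); rewrite addrC.
apply: mean_value_ineq => t t01.
have dy := line_derive (df (t *: h + y)).
have dz := line_derive (df (t *: l + z)).
have [dd ->] := is_deriveB dy dz.
split => //; rewrite -!DnSE//.
set a := t *: h + y; set b := t *: l + z.
have ar : `|a| <= r by exact: norm_segment.
have br : `|b| <= r by exact: norm_segment.
have -> : Dn k.+1 f a h - Dn k.+1 f b l =
    (Dn k.+1 f a - Dn k.+1 f b) h + Dn k.+1 f b (h - l).
  by rewrite clin_argB clinB addrA subrK.
have L20 : 0 <= L2 by exact: le_trans (normr_ge0 _) (dL2 _ yr).
rewrite (le_trans (ler_normD _ _))// lerD//; last exact/ler_clin/dL1.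
apply: ler_clin; rewrite (le_trans (Dn_lipschitz df1 dL2 ar br))//.
rewrite ler_wpM2l// /a /b opprD addrACA -scalerBr addrC.
rewrite (le_trans (ler_normD _ _))// lerD// normrZ.
by case/andP: t01 => t0 t1; rewrite ger0_norm// ler_piMl.
Qed.

(** The same comparison for first-order Taylor remainders.  The derivative along the
segments of the remainder is an increment of [Df] applied to the direction, which
reduces the estimate to the previous one for [Df]; the gain is a remainder of
second order in [h] and [l]. *)
Lemma taylor_remainder_difference (L2 L3 : R) (y h z l : U) :
  (forall k, (k < 3)%N -> forall x, differentiable (Dn k f) x) ->
  (forall x, `|x| <= r -> `|Dn 2 f x| <= L2) ->
  (forall x, `|x| <= r -> `|Dn 3 f x| <= L3) ->
  `|y| <= r -> `|h + y| <= r -> `|z| <= r -> `|l + z| <= r ->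
  `|(f (h + y) - f y - Dn 1 f y h) - (f (l + z) - f z - Dn 1 f z l)| <=
    L3 * (`|y - z| + `|h - l|) * `|h| ^+ 2 + L2 * `|h - l| * (`|h| + `|l|).
Proof.
move=> df dL2 dL3 yr hyr zr lzr.
have df0 := df 0%N isT; have df1 := df 1%N isT; have df2 := df 2%N isT.
set c := Dn 1 f y h - Dn 1 f z l.
pose phi (t : R) := f (t *: h + y) - f (t *: l + z) - t *: c.
have -> : (f (h + y) - f y - Dn 1 f y h) - (f (l + z) - f z - Dn 1 f z l) =
    phi 1 - phi 0.
  rewrite /phi !scale1r !scale0r !add0r subr0 /c.
  by rewrite !(opprD, opprK) [LHS](AC (3*3) ((1*4)*(3*6)*(2*5))).
apply: mean_value_ineq => t t01.
have dy := line_derive (df0 (t *: h + y)).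
have dz := line_derive (df0 (t *: l + z)).
have dc : is_derive t 1 (fun s : R => s *: c) c.
  have [dZ vZ] := is_diff_scalel t c.
  by split; [exact: diff_derivable|rewrite deriveE// vZ scale1r].
have [dd ->] := is_deriveB (is_deriveB dy dz) dc.
split => //; rewrite -!(DnSE (k := 0))// /c.
set a := t *: h + y; set b := t *: l + z.
have ar : `|a| <= r by exact: norm_segment.
have br : `|b| <= r by exact: norm_segment.
have -> : Dn 1 f a h - Dn 1 f b l - (Dn 1 f y h - Dn 1 f z l) =
   ((Dn 1 f a - Dn 1 f y) - (Dn 1 f b - Dn 1 f z)) h +
   (Dn 1 f b - Dn 1 f z) (h - l).
  rewrite (clin_argB (Dn 1 f b - Dn 1 f z)) !clinB subrKA.
  by rewrite !(opprD, opprK) [LHS](AC (2*2) ((1*3)*(2*4))).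
have L20 : 0 <= L2 by exact: le_trans (normr_ge0 _) (dL2 _ yr).
have L30 : 0 <= L3 by exact: le_trans (normr_ge0 _) (dL3 _ yr).
have /andP[t0 t1] := t01.
have := Dn_increment_difference df1 df2 dL2 dL3 yr ar zr br.
have := Dn_lipschitz df1 dL2 br zr.
rewrite -!scalerBr addrK !normrZ ger0_norm// => H1 H2.
rewrite (le_trans (ler_normD _ _))//.
rewrite (le_trans (lerD (ler_clin _ H2) (ler_clin _ H1)))//.
have := normr_ge0 (y - z); have := normr_ge0 (h - l).
have := normr_ge0 h; have := normr_ge0 l.
move: `|y - z| `|h - l| `|h| `|l| => A B C D D0 C0 B0 A0.
have p1 : L3 * C ^+ 2 * (t * (A + t * B)) <= L3 * C ^+ 2 * (A + B).
  rewrite ler_wpM2l ?mulr_ge0 ?sqr_ge0// (@le_trans _ _ (A + t * B))//.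
    by rewrite ler_piMl ?addr_ge0 ?mulr_ge0.
  by rewrite lerD2l ler_piMl.
have p2 : L2 * B * C * t <= L2 * B * C by rewrite ler_piMr ?mulr_ge0.
have p3 : L2 * B * D * t <= L2 * B * D by rewrite ler_piMr ?mulr_ge0.
lra.
Qed.

End TaylorEstimates.

(** * Derivatives of the increments in time of a field *)

Section DnSub.
Context {R : realType} {U V : normedModType R}.

Lemma to_clin_diffB (W : normedModType R) (F G : U -> W) (x : U) :
  differentiable F x -> differentiable G x ->
  to_clin ('d (F - G) x) = to_clin ('d F x) - to_clin ('d G x).
Proof.
move=> dF dG; apply/val_inj/funext => h.
have lin (E : U -> W) : linear ('d E x) by move=> a u v; exact: linearP.
have toE (E : U -> W) : differentiable E x -> to_clin ('d E x) h = 'd E x h.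
  move=> /diff_continuous cE.
  exact: (congr1 (fun L => L h) (to_clinE (lin E) cE)).
apply: (etrans (toE _ (differentiableB dF dG))).
rewrite (diffB dF dG).
exact: esym (congr2 (fun a b => a - b) (toE F dF) (toE G dG)).
Qed.

Lemma Dn_sub n (f g : U -> V) : Cn n f -> Cn n g ->
  forall k, (k <= n)%N -> Dn k (f - g) = Dn k f - Dn k g.
Proof.
move=> [df _] [dg _]; elim=> [//|k IH] kn.
apply/funext => x /=; rewrite (IH (ltnW kn)) to_clin_diffB//.
  exact: df.
exact: dg.
Qed.

Lemma differentiable_Dn_sub n (f g : U -> V) : Cn n f -> Cn n g ->
  forall k, (k < n)%N -> forall x, differentiable (Dn k (f - g)) x.
Proof.
move=> Cf Cg k kn x; rewrite (Dn_sub Cf Cg (ltnW kn)).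
by apply: differentiableB; [case: Cf => + _|case: Cg => + _]; exact.
Qed.

End DnSub.

(** * Bounds on a ball *)

Section Bounds.
Context {R : realType}.

(** The nonnegative elements make every supremum nonnegative, so that the finite sum
bounds each of them. *)
Lemma ereal_sup_sum_bound n (S : 'I_n -> set \bar R) :
  (forall k, exists2 z, S k z & 0 <= z)%E ->
  (\sum_(k < n) ereal_sup (S k) < +oo)%E ->
  exists2 C : R, 0 <= C & forall k (z : R), S k z%:E -> z <= C.
Proof.
move=> S0 Soo.
have sup0 k : (0 <= ereal_sup (S k))%E.
  by have [z Sz z0] := S0 k; rewrite (le_trans z0)// ereal_sup_ubound.
have sum0 : (0 <= \sum_(k < n) ereal_sup (S k))%E by exact: sume_ge0.
exists (fine (\sum_(k < n) ereal_sup (S k))%E); first exact: fine_ge0.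
move=> k z Sz; rewrite -lee_fin fineK ?ge0_fin_numE//.
rewrite (le_trans (ereal_sup_ubound Sz))//.
by rewrite (bigD1 k)//= leeDl// sume_ge0.
Qed.

(** The absolute value of the exponent makes the bound monotone in [x] whatever the
sign of [b]. *)
Lemma powR_weight_le (x r b : R) : 0 <= x <= r ->
  (1 + x) `^ b <= (1 + r) `^ `|b|.
Proof.
move=> /andP[x0 xr]; rewrite (@le_trans _ _ ((1 + x) `^ `|b|))//.
  by rewrite ler_powR ?lerDl// ler_norm.
by rewrite ge0_ler_powR ?nnegrE//; lra.
Qed.

Variables (V : normedModType R) (T : R).
Hypothesis T0 : 0 < T.

Let in0 : (0 : R) \in `[0, T]. Proof. by rewrite in_itv/= lexx ltW. Qed.
Let inT : T \in `[0, T]. Proof. by rewrite in_itv/= lexx ltW. Qed.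
Let neq0T : 0 != T. Proof. by rewrite eq_sym gt_eqF. Qed.

Lemma holder_bound (gamma : R) (A : R -> R -> V) : C2_space T gamma A ->
  exists2 C, 0 <= C & forall s t, 0 <= s -> s < t -> t <= T ->
    `|A s t| <= C * (t - s) `^ gamma.
Proof.
move=> Aoo.
have [|| C C0 CA] := @ereal_sup_sum_bound 1 (fun=> [set z | exists s t : R,
    [/\ s \in `[0, T], t \in `[0, T], s != t &
        z = (`|A s t| / `|t - s| `^ gamma)%:E]]).
- move=> _; eexists; first by exists 0, T; split.
  by rewrite lee_fin divr_ge0// powR_ge0.
- by rewrite big_ord1.
exists C => // s t s0 st tT.
have ts : 0 < t - s by rewrite subr_gt0.
rewrite -ler_pdivrMr ?powR_gt0// -{1}(gtr0_norm ts).
apply: (CA ord0); exists s, t; split => //; rewrite ?in_itv/= ?lt_eqF//; lra.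
Qed.

Lemma field_ball_bound (alpha r : R) n (beta : 'I_n.+1 -> R)
    (Phi : R -> V -> V) : field_space T alpha beta Phi ->
  exists2 L, 0 <= L & forall k s t x, (k <= n)%N -> 0 <= s -> s < t -> t <= T ->
    `|x| <= r -> `|Dn k (incr Phi s t) x| <= L * (t - s) `^ alpha.
Proof.
move=> [_ oo].
have [k | C C0 CA] := ereal_sup_sum_bound _ oo.
  eexists; first by exists 0, T, 0; split.
  by rewrite lee_fin divr_ge0// mulr_ge0// powR_ge0.
exists (C * \sum_(k < n.+1) (1 + r) `^ `|beta k|).
  by rewrite mulr_ge0// sumr_ge0// => k _; rewrite powR_ge0.
move=> k s t x kn s0 st tT xr.
have ts : 0 < t - s by rewrite subr_gt0.
have kn1 : (k < n.+1)%N by [].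
pose i := Ordinal kn1.
have x1 : 0 < 1 + `|x| by rewrite ltr_pwDl.
have w0 : 0 < (t - s) `^ alpha * (1 + `|x|) `^ beta i.
  by rewrite mulr_gt0// powR_gt0.
have : `|Dn k (incr Phi s t) x| <=
    C * ((t - s) `^ alpha * (1 + `|x|) `^ beta i).
  rewrite -ler_pdivrMr// -{1}(gtr0_norm ts).
  apply: (CA i); exists s, t, x; split => //; rewrite ?in_itv/= ?lt_eqF//; lra.
move/le_trans; apply; rewrite mulrA [leRHS]mulrAC ler_wpM2l//.
  by rewrite mulr_ge0// powR_ge0.
rewrite (@le_trans _ _ ((1 + r) `^ `|beta i|))//.
  by rewrite powR_weight_le// normr_ge0.
by rewrite (bigD1 i)//= lerDl sumr_ge0// => j _; rewrite powR_ge0.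
Qed.

Lemma field2_ball_bound (gamma r : R) m (beta1 beta2 : 'I_m.+1 -> R)
    (Psi : R -> R -> V -> V -> V) : field2_space T gamma beta1 beta2 Psi ->
  exists2 L, 0 <= L & forall k s t (p : l1prod V V), (k <= m)%N ->
    0 <= s -> s < t -> t <= T ->
    `|p| <= r -> `|Dn k (on_l1prod (Psi s t)) p| <= L * (t - s) `^ gamma.
Proof.
move=> [_ oo].
have [k | C C0 CA] := ereal_sup_sum_bound _ oo.
  eexists; first by exists 0, T, 0; split.
  by rewrite lee_fin divr_ge0// !mulr_ge0// powR_ge0.
exists (C * \sum_(k < m.+1) (1 + r) `^ `|beta1 k| * (1 + r) `^ `|beta2 k|).
  by rewrite mulr_ge0// sumr_ge0// => k _; rewrite mulr_ge0 ?powR_ge0.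
move=> k s t p kn s0 st tT pr.
have ts : 0 < t - s by rewrite subr_gt0.
have kn1 : (k < m.+1)%N by [].
pose i := Ordinal kn1.
have p1 (x : V) : 0 < 1 + `|x| by rewrite ltr_pwDl.
have w0 : 0 < (t - s) `^ gamma * (1 + `|p.1|) `^ beta1 i
    * (1 + `|p.2|) `^ beta2 i.
  by rewrite !mulr_gt0// powR_gt0.
have : `|Dn k (on_l1prod (Psi s t)) p| <=
    C * ((t - s) `^ gamma * (1 + `|p.1|) `^ beta1 i
    * (1 + `|p.2|) `^ beta2 i).
  rewrite -ler_pdivrMr// -{1}(gtr0_norm ts).
  apply: (CA i); exists s, t, p; split => //; rewrite ?in_itv/= ?lt_eqF//; lra.
move/le_trans; apply; rewrite -(mulrA (_ `^ gamma)) mulrA [leRHS]mulrAC.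
have pE : `|p| = `|p.1| + `|p.2| by [].
rewrite ler_wpM2l//.
  by rewrite mulr_ge0// powR_ge0.
rewrite (@le_trans _ _ ((1 + r) `^ `|beta1 i| * (1 + r) `^ `|beta2 i|))//.
  by rewrite ler_pM ?powR_ge0// powR_weight_le// normr_ge0/= (le_trans _ pr)//
    pE ?lerDl ?lerDr.
rewrite (bigD1 i)//= lerDl sumr_ge0// => j _.
by rewrite mulr_ge0 ?powR_ge0.
Qed.

End Bounds.

(** * Riemann sums along dyadic partitions, and sewing *)

Section Sewing.
Context {R : realType} {V : normedModType R}.
Implicit Types (Xi : R -> R -> V) (s t u a b : R).

Fixpoint riemann Xi s (p : seq R) : V :=
  if p is x :: q then Xi s x + riemann Xi x q else 0.

Lemma riemann_cat Xi s p q :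
  riemann Xi s (p ++ q) = riemann Xi s p + riemann Xi (last s p) q.
Proof.
by elim: p s => [|x p IH] s /=; rewrite ?add0r// IH addrA.
Qed.

Lemma riemannB Xi Xi' s p :
  riemann (fun u v => Xi u v - Xi' u v) s p = riemann Xi s p - riemann Xi' s p.
Proof.
elim: p s => [|x p IH] s /=; first by rewrite subrr.
by rewrite IH opprD addrACA.
Qed.

Lemma rough_sumE (W : R -> V -> V) (WW : R -> R -> V -> V -> V) (Y Yd : R -> V)
    s t p :
  rough_sum W WW Y Yd s t p =
  riemann (fun u v => incr W u v (Y u) + WW u v (Yd u) (Y u)) s p.
Proof.
rewrite /rough_sum; elim: p s => [|x p IH] s /=; first by rewrite big_geq.
by rewrite big_nat_recl//= IH.
Qed.

Lemma mesh_lt s t p (d : R) : 0 < d ->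
  path (fun x y => y - x < d) s p -> mesh s t p < d.
Proof.
move=> d0; rewrite /mesh; elim: p s => [|x p IH] s /=; first by rewrite big_geq.
by case/andP=> xs px; rewrite big_nat_recl//= gt_max xs IH.
Qed.

Fixpoint dyadic n s t : seq R :=
  if n is n'.+1 then dyadic n' s ((s + t) / 2) ++ dyadic n' ((s + t) / 2) t
  else [:: t].

Lemma last_dyadic n s t : last s (dyadic n s t) = t.
Proof. by elim: n s t => [//|n IH] s t /=; rewrite last_cat !IH. Qed.

Lemma dyadic_path n s t (d : R) : s < t -> t - s < d * 2 ^+ n ->
  path (fun x y => (x < y) && (y - x < d)) s (dyadic n s t).
Proof.
elim: n s t => [|n IH] s t st /=; first by rewrite expr0 mulr1 => ->; rewrite st.
rewrite exprS => h; rewrite cat_path last_dyadic !IH//; lra.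
Qed.

Lemma dyadic_partition n s t (d : R) : s < t -> t - s < d * 2 ^+ n ->
  itv_partition s t (dyadic n s t) /\
  path (fun x y => y - x < d) s (dyadic n s t).
Proof.
move=> st h; have P := dyadic_path st h; split.
  split; last by rewrite last_dyadic.
  by apply: sub_path P => x y /andP[].
by apply: sub_path P => x y /andP[].
Qed.

Lemma dyadic_mesh_small (h d : R) : 0 < d -> exists N, forall n, (N <= n)%N ->
  h < d * 2 ^+ n.
Proof.
move=> d0; exists (Num.bound (`|h| / d)) => n Nn.
have hd : 0 <= `|h| / d by rewrite divr_ge0// ltW.
rewrite (le_lt_trans (ler_norm h))// -ltr_pdivrMl// mulrC.
rewrite (lt_trans (archi_boundP hd))// (@le_lt_trans _ _ n%:R) ?ler_nat//.
by rewrite -natrX ltr_nat ltn_expl.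
Qed.

(** The sum of the geometric series with ratio [2^(1 - theta)].  At each dyadic
subdivision the number of intervals doubles while the defect on each is divided by
[2^theta]. *)
Definition sewing_constant (theta : R) : R := (1 - 2 `^ (1 - theta))^-1.

Lemma sewing_constantP (theta : R) : 1 < theta ->
  0 < sewing_constant theta /\
  sewing_constant theta = 1 + sewing_constant theta * (2 * 2^-1 `^ theta).
Proof.
move=> th1; have E : 2 * 2^-1 `^ theta = 2 `^ (1 - theta) :> R.
  rewrite powRD ?powRr1//; last by rewrite pnatr_eq0 implybT.
  by rewrite powRN -powRN -(powR_inv1 (ler0n R 2)) -powRrM mulN1r.
have q1 : 2 `^ (1 - theta) < 1 :> R.
  rewrite -opprB powRN invf_lt1 ?powR_gt0//.
  have th0 : 0 < theta - 1 by rewrite subr_gt0.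
  have := @gt0_ltr_powR R _ th0 1 2; rewrite !nnegrE powR1; apply => //.
  by rewrite ltr1n.
rewrite /sewing_constant E; split; first by rewrite invr_gt0 subr_gt0.
field; lra.
Qed.

(** The sewing estimate, by induction on the dyadic level: an interval is cut at its
midpoint, the defect there costs [K (t - s)^theta], and the two halves are treated
by induction.  The constant closes the induction because it is a fixed point
([sewing_constantP]). *)
Lemma sewing_bound Xi a b (K theta : R) : 1 < theta -> 0 <= K ->
  (forall s u t, a <= s -> s < u -> u < t -> t <= b ->
     `|Xi s t - Xi s u - Xi u t| <= K * (t - s) `^ theta) ->
  forall n s t, a <= s -> s < t -> t <= b ->
    `|riemann Xi s (dyadic n s t) - Xi s t| <=
      sewing_constant theta * K * (t - s) `^ theta.
Proof.
move=> th1 K0 dXi; have [c0 cE] := sewing_constantP th1.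
elim=> [|n IH] s t sa st tb /=.
  by rewrite addr0 subrr normr0 !mulr_ge0 ?powR_ge0// ltW.
set m := (s + t) / 2; have sm : s < m by rewrite /m; lra.
have mt : m < t by rewrite /m; lra.
rewrite riemann_cat last_dyadic.
have -> : riemann Xi s (dyadic n s m) + riemann Xi m (dyadic n m t) - Xi s t =
   (riemann Xi s (dyadic n s m) - Xi s m) +
   (riemann Xi m (dyadic n m t) - Xi m t) - (Xi s t - Xi s m - Xi m t).
  rewrite !(opprD, opprK) [RHS](AC (2*2*3) (1*3*5*(2*6)*(4*7))).
  by rewrite /= !addNr !addr0.
rewrite (le_trans (ler_normB _ _))//.
have H1 := IH s m sa sm (ltac:(lra)).
have H2 := IH m t (ltac:(lra)) mt tb.
have H3 := dXi s m t sa sm mt tb.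
rewrite (le_trans (lerD (le_trans (ler_normD _ _) (lerD H1 H2)) H3))//.
have -> : m - s = (t - s) * 2^-1 by rewrite /m; lra.
have -> : t - m = (t - s) * 2^-1 by rewrite /m; lra.
have ts0 : 0 <= t - s by lra.
rewrite powRM ?invr_ge0// [in leRHS]cE.
lra.
Qed.

(** The integrals from [0] control the Riemann sums over [[s, t]]: a fine dyadic
partition of [[0, s]] followed by one of [[s, t]] is a fine partition of [[0, t]],
and the sums over [[0, s]] converge as well. *)
Lemma rough_integral_dyadic (W : R -> V -> V) (WW : R -> R -> V -> V -> V)
    (Y : R -> V) (T : R) (J : R -> V) :
  (forall t, 0 <= t -> t <= T ->
     is_nl_rough_integral W WW Y Y 0 t (J t - J 0)) ->
  forall s t (e : R), 0 <= s -> s < t -> t <= T -> 0 < e ->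
  exists N, forall n, (N <= n)%N ->
    `|riemann (fun u v => incr W u v (Y u) + WW u v (Y u) (Y u)) s
       (dyadic n s t) - (J t - J s)| < e.
Proof.
move=> Jint s t e s0 st tT e0; set Xi := fun u v => _.
have t0 : 0 <= t by lra.
have sT : s <= T by lra.
have e20 : 0 < e / 2 by rewrite divr_gt0.
have [dt dt0 Pt] := Jint t t0 tT _ e20.
have [N1 PN1] := dyadic_mesh_small t dt0.
(* For [s = 0] the first block is empty: the points of a dyadic partition of
   [[0, 0]] would not increase strictly. *)
have [s00|sn0] := eqVneq s 0.
  subst s; exists N1 => n /PN1 Nn.
  have [p1 p2] := @dyadic_partition n 0 t dt st (ltac:(by rewrite subr0)).
  have := Pt _ p1 (mesh_lt t dt0 p2); rewrite rough_sumE => /lt_trans; apply; lra.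
have {s0 sn0} s0 : 0 < s by rewrite lt_def sn0.
have [ds ds0 Ps] := Jint s (ltW s0) sT _ e20.
have [N2 PN2] := dyadic_mesh_small s ds0.
exists (maxn N1 N2) => n; rewrite geq_max => /andP[/PN1 n1 /PN2 n2].
have H2 : s - 0 < dt * 2 ^+ n by lra.
have H3 : t - s < dt * 2 ^+ n by lra.
have H1 : s - 0 < ds * 2 ^+ n by lra.
have [p1 p2] := dyadic_partition s0 H1.
have [q1 q2] := dyadic_partition s0 H2.
have [r1 r2] := dyadic_partition st H3.
have := Ps _ p1 (mesh_lt s ds0 p2).
have : path (fun x y => y - x < dt) 0 (dyadic n 0 s ++ dyadic n s t).
  by rewrite cat_path q2 last_dyadic.
move=> /(mesh_lt t dt0)/(Pt _ (itv_partition_cat q1 r1)).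
rewrite !rough_sumE riemann_cat last_dyadic -/Xi => A B.
set X := riemann Xi s _; set X0 := riemann Xi 0 _ in A B.
have -> : X - (J t - J s) = (X0 + X - (J t - J 0)) - (X0 - (J s - J 0)).
  rewrite !(opprD, opprK) [RHS](AC (2*2*(1*2)) (2*3*6*(1*5)*(4*7))).
  by rewrite /= !subrr !addr0 addrA.
by rewrite (le_lt_trans (ler_normB _ _))//; lra.
Qed.

Lemma sewing_limit (Xi : R -> R -> V) (a b K theta s t : R) (I : V) :
  1 < theta -> 0 <= K -> a <= s -> s < t -> t <= b ->
  (forall s u t, a <= s -> s < u -> u < t -> t <= b ->
     `|Xi s t - Xi s u - Xi u t| <= K * (t - s) `^ theta) ->
  (forall e, 0 < e -> exists n, `|riemann Xi s (dyadic n s t) - I| < e) ->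
  `|I - Xi s t| <= sewing_constant theta * K * (t - s) `^ theta.
Proof.
move=> th1 K0 sa st tb dXi cvI; apply/ler_addgt0Pr => e e0.
have [n In] := cvI e e0.
have B := sewing_bound th1 K0 dXi n sa st tb.
rewrite (le_trans (ler_distD (riemann Xi s (dyadic n s t)) _ _))//.
by rewrite addrC lerD// distrC ltW.
Qed.

Lemma norm_eq0_geometric (x : V) (C : R) :
  (forall n, `|x| * 2 ^+ n <= C) -> x = 0.
Proof.
move=> xC; apply/eqP; rewrite -normr_eq0; apply/negPn/negP => x0.
have x1 : 0 < `|x| by rewrite lt_def x0 normr_ge0.
have [N /(_ N (leqnn N))] := dyadic_mesh_small C x1.
by rewrite ltNge xC.
Qed.

End Sewing.

Lemma powR_natmul {R : realType} (x a : R) (n : nat) :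
  x `^ (n%:R * a) = (x `^ a) ^+ n.
Proof. by rewrite mulrC powRrM powR_mulrn// powR_ge0. Qed.

(** * The germ of a solution and its defect of additivity *)

Section Contraction.
Context {R : realType} {V : normedModType R}.
Variables (T alpha : R) (W : R -> V -> V) (WW : R -> R -> V -> V -> V).
Variables (L H r : R).
Hypothesis alpha0 : 0 < alpha.
Hypothesis L0 : 0 <= L.
Hypothesis H0 : 0 <= H.
Hypothesis dW : forall s t, 0 <= s -> s < t -> t <= T ->
  forall k, (k < 3)%N -> forall x, differentiable (Dn k (incr W s t)) x.
Hypothesis bW : forall k s t x, (k <= 3)%N -> 0 <= s -> s < t -> t <= T ->
  `|x| <= r -> `|Dn k (incr W s t) x| <= L * (t - s) `^ alpha.
Hypothesis dWW : forall s t, 0 <= s -> s < t -> t <= T ->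
  forall k, (k < 2)%N -> forall p, differentiable (Dn k (on_l1prod (WW s t))) p.
Hypothesis bWW : forall k s t (p : l1prod V V), (k <= 2)%N ->
  0 <= s -> s < t -> t <= T -> `|p| <= 2 * r ->
  `|Dn k (on_l1prod (WW s t)) p| <= L * (t - s) `^ (2 * alpha).
Hypothesis chenW : chen T W WW.

Definition germ (Y : R -> V) (s t : R) : V :=
  incr W s t (Y s) + WW s t (Y s) (Y s).

Definition remainder (Y : R -> V) (s t : R) : V :=
  incr Y s t - incr W s t (Y s).

Definition diag (x : V) : l1prod V V := (x, x).

Lemma norm_diag x : `|diag x| = 2 * `|x|.
Proof. by rewrite mulr2n mulrDl mul1r. Qed.

(** Chen's relation turns the defect of [WW] at the fixed pair [(Y_s, Y_s)] into
[DW_{u,t}(Y_s)] applied to [W_{s,u}(Y_s)].  This is [Y_{s,u}] minus the remainder: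
the first part completes [W_{u,t}(Y_u) - W_{u,t}(Y_s)] to a Taylor remainder. *)
Lemma germ_defect (Y : R -> V) (s u t : R) :
  0 <= s -> s < u -> u < t -> t <= T ->
  germ Y s t - germ Y s u - germ Y u t =
  - (incr W u t (Y u) - incr W u t (Y s)
       - Dn 1 (incr W u t) (Y s) (incr Y s u))
  - Dn 1 (incr W u t) (Y s) (remainder Y s u)
  - (on_l1prod (WW u t) (diag (Y u)) - on_l1prod (WW u t) (diag (Y s))).
Proof.
move=> s0 su ut tT.
have u0 : 0 <= u by lra.
have sI : s \in `[0, T] by rewrite in_itv/=; lra.
have uI : u \in `[0, T] by rewrite in_itv/=; lra.
have tI : t \in `[0, T] by rewrite in_itv/=; lra.
have := chenW (Y s) (Y s) sI uI tI.
rewrite -(DnSE (k := 0))//; last by have := dW u0 ut tT (k := 0) isT.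
rewrite /remainder (clin_argB _ (incr Y s u)).
set D1 := Dn 1 (incr W u t) (Y s) (incr Y s u) => <-.
rewrite -[on_l1prod _ (diag (Y u))]/(WW u t (Y u) (Y u)).
rewrite -[on_l1prod _ (diag (Y s))]/(WW u t (Y s) (Y s)).
rewrite /germ.
have -> : incr W s t (Y s) = incr W s u (Y s) + incr W u t (Y s).
  rewrite [RHS]addrC; apply: esym.
  exact: (subrKA (W u (Y s)) (W t (Y s)) (- W s (Y s))).
move: (incr W s u _) (incr W u t (Y s)) (incr W u t _) (WW s t _ _) (WW s u _ _)
  (WW u t _ (Y s)) (WW u t _ _) => a b c d e f g.
move: (incr W u t (Y u)) => h.
rewrite !(opprD, opprK) [LHS](AC (3*2*2) (2*3*5*6*7*(1*4))).
rewrite [RHS](AC (3*(1*3)*2) (2*5*6*1*8*(3*4)*(7*9))) /=.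
by rewrite !(subrr, addNr, addr0).
Qed.

(** The sum of [2 H^2 + 2 H], [H + 1] and [8 H + 2], the contributions of the three
terms of [germ_defect]. *)
Definition defect_constant : R := L * (2 * H ^+ 2 + 11 * H + 3).

(** All three terms of [germ_defect] are of order [(t - s)^(3 alpha)]: the Taylor
remainder has [alpha] from the field and twice [alpha] from the increment of the
solution, the second term [alpha] from the field and [2 alpha] from the remainder,
the third [2 alpha] from the field and [alpha] from the increment. *)
Lemma germ_defect_difference (Y Z : R -> V) (K s u t : R) :
  0 <= s -> s < u -> u < t -> t <= T -> t - s <= 1 -> 0 <= K ->
  `|Y s| <= r -> `|Y u| <= r -> `|Z s| <= r -> `|Z u| <= r ->
  `|incr Y s u| <= H * (u - s) `^ alpha ->
  `|incr Z s u| <= H * (u - s) `^ alpha ->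
  `|remainder Y s u| <= H * (u - s) `^ (2 * alpha) ->
  `|Y s - Z s| <= K ->
  `|incr Y s u - incr Z s u| <= K * (u - s) `^ alpha ->
  `|remainder Y s u - remainder Z s u| <= K * (u - s) `^ (2 * alpha) ->
  `|(germ Y s t - germ Y s u - germ Y u t) -
    (germ Z s t - germ Z s u - germ Z u t)|
    <= defect_constant * K * (t - s) `^ (3 * alpha).
Proof.
move=> s0 su ut tT ts1 K0 Ysr Yur Zsr Zur.
rewrite !powR_natmul.
set w := (t - s) `^ alpha.
have mono x y : 0 <= x -> x <= y -> x `^ alpha <= y `^ alpha.
  by move=> x0 xy; rewrite ge0_ler_powR ?nnegrE ?(ltW alpha0)//; lra.
have w0 : 0 <= w by exact: powR_ge0.
have w1 : w <= 1.
  by rewrite (le_trans (mono _ 1 _ _)) ?powR1//; lra.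
have suw : (u - s) `^ alpha <= w by apply: mono; lra.
have utw : (t - u) `^ alpha <= w by apply: mono; lra.
have suw2 : ((u - s) `^ alpha) ^+ 2 <= w ^+ 2 by rewrite lerXn2r ?nnegrE ?powR_ge0.
move=> /le_trans/(_ (ler_wpM2l H0 suw)) hY.
move=> /le_trans/(_ (ler_wpM2l H0 suw)) hZ.
move=> /le_trans/(_ (ler_wpM2l H0 suw2)) hR D0.
move=> /le_trans/(_ (ler_wpM2l K0 suw)) hD.
move=> /le_trans/(_ (ler_wpM2l K0 suw2)) hRD.
have u0 : 0 <= u by lra.
have bf k x : (k <= 3)%N -> `|x| <= r -> `|Dn k (incr W u t) x| <= L * w.
  by move=> k3 xr; rewrite (le_trans (bW k3 u0 ut tT xr))// ler_wpM2l.
have bg k (p : l1prod V V) : (k <= 2)%N -> `|p| <= 2 * r ->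
    `|Dn k (on_l1prod (WW u t)) p| <= L * w ^+ 2.
  move=> k2 pr; rewrite (le_trans (bWW k2 u0 ut tT pr))//.
  by rewrite powR_natmul ler_wpM2l// lerXn2r ?nnegrE ?powR_ge0.
have df := dW u0 ut tT; have dg := dWW u0 ut tT.
rewrite !germ_defect//.
set f := incr W u t in bf df *; set g := on_l1prod (WW u t) in bg dg *.
have YuE : Y u = incr Y s u + Y s by rewrite /incr subrK.
have ZuE : Z u = incr Z s u + Z s by rewrite /incr subrK.
have diagD x y : diag (x + y) = diag x + diag y by [].
have diagr x : `|x| <= r -> `|diag x| <= 2 * r.
  by move=> xr; rewrite norm_diag ler_wpM2l.
have Lw0 : 0 <= L * w by rewrite mulr_ge0.
have Lw20 : 0 <= L * w ^+ 2 by rewrite mulr_ge0// sqr_ge0.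
have Hw0 : 0 <= H * w by rewrite mulr_ge0.
have Kw : K * w <= K by rewrite ler_piMr.
have taylor : `|(f (Y u) - f (Y s) - Dn 1 f (Y s) (incr Y s u)) -
     (f (Z u) - f (Z s) - Dn 1 f (Z s) (incr Z s u))| <=
    L * (2 * H ^+ 2 + 2 * H) * K * w ^+ 3.
  rewrite YuE ZuE; apply: (le_trans (taylor_remainder_difference (r := r)
    df (fun x => bf 2%N x isT) (fun x => bf 3%N x isT) Ysr _ Zsr _)).
  - by rewrite -YuE.
  - by rewrite -ZuE.
  have e1 : `|incr Y s u| ^+ 2 <= (H * w) ^+ 2 by rewrite lerXn2r ?nnegrE.
  have e2 : `|Y s - Z s| + `|incr Y s u - incr Z s u| <= 2 * K by lra.
  have e3 : `|incr Y s u| + `|incr Z s u| <= 2 * (H * w) by lra.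
  rewrite (@le_trans _ _ (L * w * (2 * K) * (H * w) ^+ 2
      + L * w * (K * w) * (2 * (H * w))))//; last lra.
  by rewrite lerD// ler_pM ?mulr_ge0 ?addr_ge0 ?sqr_ge0// ler_wpM2l.
have rest : `|Dn 1 f (Y s) (remainder Y s u) - Dn 1 f (Z s) (remainder Z s u)|
    <= L * (H + 1) * K * w ^+ 3.
  have -> : Dn 1 f (Y s) (remainder Y s u) - Dn 1 f (Z s) (remainder Z s u) =
      (Dn 1 f (Y s) - Dn 1 f (Z s)) (remainder Y s u) +
      Dn 1 f (Z s) (remainder Y s u - remainder Z s u).
    by rewrite clin_argB clinB addrA subrK.
  have lip := Dn_lipschitz (df 1%N isT) (fun x => bf 2%N x isT) Ysr Zsr.
  rewrite (le_trans (ler_normD _ _))//.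
  rewrite (le_trans (lerD (ler_clin _ lip) (ler_clin _ (bf 1%N _ isT Zsr))))//.
  rewrite (@le_trans _ _ (L * w * K * (H * w ^+ 2) + L * w * (K * w ^+ 2)))//;
    last lra.
  by rewrite lerD// ?ler_wpM2l// ler_pM ?mulr_ge0// ler_wpM2l.
(* The factors [4] and [2] below are [2 * 2] and [2]: the norm on pairs is the sum
   of the norms, so it doubles on the diagonal. *)
have second : `|(g (diag (Y u)) - g (diag (Y s))) -
     (g (diag (Z u)) - g (diag (Z s)))| <= L * (8 * H + 2) * K * w ^+ 3.
  rewrite YuE ZuE (diagD (incr Y s u)) (diagD (incr Z s u)).
  apply: (le_trans (Dn_increment_difference (k := 0) (r := 2 * r)
    (dg 0%N isT) (dg 1%N isT) (fun x => bg 1%N x isT) (fun x => bg 2%N x isT)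
    (diagr _ Ysr) _ (diagr _ Zsr) _)).
  - by have := diagr _ Yur; rewrite YuE.
  - by have := diagr _ Zur; rewrite ZuE.
  have diagB x y : diag x - diag y = diag (x - y) by [].
  rewrite !diagB !norm_diag.
  rewrite (@le_trans _ _ (L * w ^+ 2 * (4 * K) * (2 * (H * w))
      + L * w ^+ 2 * (2 * (K * w))))//; last lra.
  rewrite lerD//; last by rewrite ler_wpM2l// ler_wpM2l.
  rewrite ler_pM ?mulr_ge0 ?addr_ge0 ?mulr_ge0//; last by rewrite ler_wpM2l.
  by rewrite ler_wpM2l//; lra.
have -> : forall a b c a' b' c' : V, - a - b - c - (- a' - b' - c') =
   - (a - a') - (b - b') - (c - c').
  by move=> *; rewrite !(opprD, opprK) [LHS](AC (3*3) ((1*4)*(2*5)*(3*6))).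
rewrite (le_trans (ler_normB _ _))// (le_trans (lerD (ler_normB _ _) (lexx _)))//.
rewrite normrN (le_trans (lerD (lerD taylor rest) second))//.
rewrite /defect_constant; lra.
Qed.

(** * Contraction of the distance between two solutions *)

(** What the contraction uses of a solution: the ball of radius [r] is the one on which
the fields are controlled, and a single [H] serves for the increments and the
remainders. *)
Definition rough_solution (Y : R -> V) : Prop :=
  [/\ forall t, 0 <= t -> t <= T -> `|Y t| <= r,
      forall s t, 0 <= s -> s < t -> t <= T ->
        `|incr Y s t| <= H * (t - s) `^ alpha,
      forall s t, 0 <= s -> s < t -> t <= T ->
        `|remainder Y s t| <= H * (t - s) `^ (2 * alpha) &
      forall t, 0 <= t -> t <= T ->
        is_nl_rough_integral W WW Y Y 0 t (Y t - Y 0)].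

Definition rough_close (Y Z : R -> V) (a b K : R) : Prop :=
  forall s t, a <= s -> s < t -> t <= b ->
    `|incr Y s t - incr Z s t| <= K * (t - s) `^ alpha /\
    `|remainder Y s t - remainder Z s t| <= K * (t - s) `^ (2 * alpha).

Hypothesis alpha3 : 1 < 3 * alpha.

Definition contraction_constant : R :=
  sewing_constant (3 * alpha) * defect_constant + 3 * L.

Let defect_constant_ge0 : 0 <= defect_constant.
Proof.
by rewrite mulr_ge0// !addr_ge0// mulr_ge0// sqr_ge0.
Qed.

Let sewing_defect_ge0 : 0 <= sewing_constant (3 * alpha) * defect_constant.
Proof. by rewrite mulr_ge0// ltW// (sewing_constantP alpha3).1. Qed.

(** Riemann sums are linear in the germ, so sewing applies to the difference of the
germs of two solutions, whose defect is proportional to their distance [K]. *)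
Lemma solution_sewing (Y Z : R -> V) (a b K s t : R) :
  rough_solution Y -> rough_solution Z ->
  0 <= a -> b <= T -> b - a <= 1 -> 0 <= K ->
  (forall u, a <= u -> u <= b -> `|Y u - Z u| <= K) ->
  rough_close Y Z a b K ->
  a <= s -> s < t -> t <= b ->
  `|(incr Y s t - incr Z s t) - (germ Y s t - germ Z s t)| <=
    sewing_constant (3 * alpha) * (defect_constant * K)
      * (t - s) `^ (3 * alpha).
Proof.
move=> [Yr Yh Yrem Yint] [Zr Zh Zrem Zint] a0 bT ba1 K0 D0 DK sa st tb.
have s0 : 0 <= s by lra.
have tT : t <= T by lra.
apply: (sewing_limit (Xi := fun u v => germ Y u v - germ Z u v) (a := a) (b := b))
  => //.
- by rewrite mulr_ge0.
- move=> s' u t' as' su ut tb'.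
  have s'0 : 0 <= s' by lra.
  have u0 : 0 <= u by lra.
  have sT : s' <= T by lra.
  have uT : u <= T by lra.
  have tT' : t' <= T by lra.
  have [DK1 DK2] := DK s' u as' su (ltac:(lra)).
  have -> : forall x y z x' y' z' : V, x - x' - (y - y') - (z - z') =
      (x - y - z) - (x' - y' - z').
    by move=> *; rewrite !(opprD, opprK) [LHS](AC (2*2*2) ((1*3*5)*(2*4*6))).
  apply: germ_defect_difference; rewrite ?Yr ?Zr ?Yh ?Zh ?Yrem// ?D0//; lra.
move=> e e0; have e20 : 0 < e / 2 by rewrite divr_gt0.
have [N1 Y1] := rough_integral_dyadic Yint s0 st tT e20.
have [N2 Z2] := rough_integral_dyadic Zint s0 st tT e20.
exists (maxn N1 N2); rewrite riemannB.
have := Y1 _ (leq_maxl N1 N2); have := Z2 _ (leq_maxr N1 N2).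
rewrite -/(germ Y) -/(germ Z) -/(incr Y s t) -/(incr Z s t) => Z3 Y3.
have -> : forall x x' y y' : V, x - x' - (y - y') = (x - y) - (x' - y').
  by move=> *; rewrite !(opprD, opprK) [LHS](AC (2*2) ((1*3)*(2*4))).
rewrite (le_lt_trans (ler_normB _ _))//; lra.
Qed.

(** The distance is reproduced with the factor [contraction_constant * (b - a)^alpha].
For the remainders, the sewing error gains [alpha] over the required order
[2 alpha], and the difference of the second-level germs is [(t - s)^(2 alpha)]
times [Y_s - Z_s], which is at most [K (b - a)^alpha] because the solutions agree
at [a].  For the increments, the difference of the first-level germs is added. *)
Lemma rough_close_half (Y Z : R -> V) (a b K : R) :
  rough_solution Y -> rough_solution Z ->
  0 <= a -> b <= T -> b - a <= 1 -> 0 <= K ->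
  contraction_constant * (b - a) `^ alpha <= 2^-1 ->
  Y a = Z a -> rough_close Y Z a b K -> rough_close Y Z a b (K / 2).
Proof.
move=> Ysol Zsol a0 bT ba1 K0 small YZa DK s t sa st tb.
have [Yr Yh Yrem Yint] := Ysol; have [Zr Zh Zrem Zint] := Zsol.
have mono x y : 0 <= x -> x <= y -> x `^ alpha <= y `^ alpha.
  by move=> x0 xy; rewrite ge0_ler_powR ?nnegrE ?(ltW alpha0)//; lra.
set k := (b - a) `^ alpha in small.
have k0 : 0 <= k by exact: powR_ge0.
have k1 : k <= 1 by rewrite (le_trans (mono _ 1 _ _)) ?powR1//; lra.
have D0 u : a <= u -> u <= b -> `|Y u - Z u| <= K * k.
  rewrite le_eqVlt => /predU1P[<- _|au ub].
    by rewrite YZa subrr normr0 mulr_ge0.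
  have -> : Y u - Z u = incr Y a u - incr Z a u.
    by rewrite /incr YZa opprB addrA subrK.
  rewrite (le_trans (DK a u (lexx a) au ub).1)// ler_wpM2l// mono//; lra.
have D1 u : a <= u -> u <= b -> `|Y u - Z u| <= K.
  by move=> au ub; rewrite (le_trans (D0 u au ub))// ler_piMr.
have s0 : 0 <= s by lra.
have tT : t <= T by lra.
have sb : s <= b by lra.
have sT : s <= T by lra.
have := solution_sewing Ysol Zsol a0 bT ba1 K0 D1 DK sa st tb.
have Ysr := Yr s s0 sT; have Zsr := Zr s s0 sT; have Ds := D0 s sa sb.
have first := Dn_lipschitz (dW s0 st tT (k := 0) isT)
  (fun x => bW (k := 1) isT s0 st tT) Ysr Zsr.
have diagr x : `|x| <= r -> `|diag x| <= 2 * r.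
  by move=> xr; rewrite norm_diag ler_wpM2l.
have second := Dn_lipschitz (dWW s0 st tT (k := 0) isT)
  (fun x => bWW (k := 1) isT s0 st tT) (diagr _ Ysr) (diagr _ Zsr).
move: second; rewrite -[diag (Y s) - _]/(diag (Y s - Z s)) norm_diag.
rewrite -[Dn 0 _ (diag (Y s))]/(WW s t (Y s) (Y s)).
rewrite -[Dn 0 _ (diag (Z s))]/(WW s t (Z s) (Z s)) => second.
move: first; rewrite -[Dn 0 _ (Y s)]/(incr W s t (Y s)).
rewrite -[Dn 0 _ (Z s)]/(incr W s t (Z s)) => first.
rewrite /remainder /germ !powR_natmul in second *.
set w := (t - s) `^ alpha in first second *.
have w0 : 0 <= w by exact: powR_ge0.
have wk : w <= k by apply: mono; lra.
move: (incr Y s t) (incr Z s t) (incr W s t (Y s)) (incr W s t (Z s))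
  (WW s t (Y s) (Y s)) (WW s t (Z s) (Z s)) first second
  => y z f1 f2 g1 g2 first second sew.
set c := sewing_constant _ in small sew; set d := defect_constant in small sew.
have {}first : `|f1 - f2| <= L * k * K * w.
  rewrite (le_trans first)// -[leRHS](_ : L * w * (K * k) = _); last by ring.
  by rewrite ler_wpM2l ?mulr_ge0.
have {}second : `|g1 - g2| <= 2 * L * k * K * w ^+ 2.
  rewrite (le_trans second)//.
  rewrite -[leRHS](_ : L * w ^+ 2 * (2 * (K * k)) = _); last by ring.
  by rewrite ler_wpM2l ?mulr_ge0 ?sqr_ge0// ler_wpM2l.
have {}sew : `|y - z - (f1 + g1 - (f2 + g2))| <= c * d * k * K * w ^+ 2.
  rewrite (le_trans sew)//.
  rewrite -[leRHS](_ : c * (d * K) * (w ^+ 2 * k) = _); last by ring.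
  by rewrite exprSr ler_wpM2l ?ler_wpM2l ?sqr_ge0// mulrA mulr_ge0.
have rem : `|y - f1 - (z - f2)| <= (c * d + 2 * L) * k * K * w ^+ 2.
  have -> : y - f1 - (z - f2) = (y - z - (f1 + g1 - (f2 + g2))) + (g1 - g2).
    rewrite !(opprD, opprK) [RHS](AC (2*(2*2)*2) ((1*3)*(2*5)*(4*7)*(6*8))) /=.
    by rewrite addNr addrN !addr0.
  by rewrite (le_trans (ler_normD _ _))//; lra.
have half : (c * d + 3 * L) * k * K <= 2^-1 * K by rewrite ler_wpM2r.
split.
  have -> : y - z = (y - f1 - (z - f2)) + (f1 - f2).
    rewrite !(opprD, opprK) [RHS](AC (2*2*2) ((1*3)*(2*5)*(4*6))) /=.
    by rewrite addNr addrN !addr0.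
  have w21 : w ^+ 2 <= w by rewrite expr2 ler_piMr//; lra.
  rewrite (le_trans (ler_normD _ _))//.
  have cd0 : 0 <= (c * d + 2 * L) * k * K.
    by rewrite !mulr_ge0// addr_ge0// mulr_ge0.
  have := ler_wpM2l cd0 w21; have := ler_wpM2r w0 half; lra.
rewrite (le_trans rem)//.
have Lk : 0 <= L * k * K * w ^+ 2 by rewrite !mulr_ge0// sqr_ge0.
have := ler_wpM2r (sqr_ge0 w) half; lra.
Qed.

Lemma rough_close_eq (Y Z : R -> V) (a b K : R) :
  rough_solution Y -> rough_solution Z ->
  0 <= a -> b <= T -> b - a <= 1 -> 0 <= K ->
  contraction_constant * (b - a) `^ alpha <= 2^-1 ->
  Y a = Z a -> rough_close Y Z a b K ->
  forall t, a < t -> t <= b -> Y t = Z t.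
Proof.
move=> Ysol Zsol a0 bT ba1 K0 small YZa DK t at_ tb.
have DKn n : rough_close Y Z a b (K / 2 ^+ n).
  elim: n => [|n IH]; first by rewrite expr0 divr1.
  rewrite exprSr invfM mulrA; apply: rough_close_half => //.
  by rewrite divr_ge0// exprn_ge0.
apply/eqP; rewrite -subr_eq0; apply/eqP.
apply: (@norm_eq0_geometric _ _ _ (K * (t - a) `^ alpha)) => n.
have [+ _] := DKn n a t (lexx a) at_ tb.
have -> : incr Y a t - incr Z a t = Y t - Z t.
  by rewrite /incr YZa opprB addrA subrK.
by rewrite mulrAC ler_pdivlMr// exprn_gt0.
Qed.

Lemma rough_solution_close (Y Z : R -> V) (a b : R) :
  rough_solution Y -> rough_solution Z -> 0 <= a -> b <= T ->
  rough_close Y Z a b (2 * H).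
Proof.
move=> [_ Yh Yr _] [_ Zh Zr _] a0 bT s t sa st tb.
have s0 : 0 <= s by lra.
have tT : t <= T by lra.
split; rewrite -mulrA mulr_natl mulr2n (le_trans (ler_normB _ _))// lerD//.
- exact: Yh.
- exact: Zh.
- exact: Yr.
- exact: Zr.
Qed.

Lemma exists_small_step (C : R) : 0 <= C ->
  exists h, [/\ 0 < h, h <= 1 & C * h `^ alpha <= 2^-1].
Proof.
move=> C0; pose x := (2 * (C + 1))^-1.
have x0 : 0 < x by rewrite invr_gt0; lra.
have x1 : x <= 1 by rewrite invf_le1//; lra.
exists (x `^ alpha^-1); split; first exact: powR_gt0.
  have -> : 1 = 1 `^ alpha^-1 :> R by rewrite powR1.
  have a0 : 0 <= alpha^-1 by rewrite invr_ge0 ltW.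
  by rewrite ge0_ler_powR ?nnegrE ?(ltW x0).
rewrite -powRrM mulVf ?gt_eqF// powRr1 ?(ltW x0)//.
rewrite ler_pdivrMr; last lra.
lra.
Qed.

Lemma rough_solution_unique (Y Z : R -> V) :
  rough_solution Y -> rough_solution Z -> Y 0 = Z 0 ->
  forall t, 0 <= t -> t <= T -> Y t = Z t.
Proof.
move=> Ysol Zsol YZ0.
have C0 : 0 <= contraction_constant by rewrite addr_ge0// mulr_ge0.
have [h [h0 h1 Ch]] := exists_small_step C0.
suff steps n : forall t, 0 <= t -> t <= T -> t <= n%:R * h -> Y t = Z t.
  move=> t t0 tT; apply: (steps (Num.bound (t / h))) => //.
  by rewrite -ler_pdivrMr// ltW// archi_boundP// divr_ge0// ltW.
elim: n => [|n IH] t t0 tT tn.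
  by have -> : t = 0 by lra.
have [|nt] := leP t (n%:R * h); first exact: IH.
have nh0 : 0 <= n%:R * h by rewrite mulr_ge0// ltW.
have th : t - n%:R * h <= h by rewrite -natr1 in tn; lra.
apply: (@rough_close_eq Y Z (n%:R * h) t (2 * H)) => //.
- lra.
- by rewrite mulr_ge0.
- rewrite (le_trans _ Ch)// ler_wpM2l// ge0_ler_powR ?nnegrE ?(ltW alpha0)//; lra.
- by apply: IH => //; lra.
- exact: rough_solution_close.
Qed.

End Contraction.

(** * Uniqueness of solutions *)

Section SolutionBounds.
Context {R : realType} {V : normedModType R}.
Variables (T alpha : R) (W : R -> V -> V) (WW : R -> R -> V -> V -> V) (xi : V).
Hypothesis T0 : 0 < T.
Hypothesis alpha0 : 0 < alpha.

(** The constant may be enlarged at will, so that one [H] serves two solutions; the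
ball has to grow with it. *)
Lemma solution_is_rough_solution (Y : R -> V) : is_solution T alpha W WW xi Y ->
  exists2 H0, 0 <= H0 & forall H, H0 <= H ->
    rough_solution T alpha W WW H (`|xi| + H * T `^ alpha) Y.
Proof.
move=> [Yh Y0 [_ _ Yrem] Yint].
have [H1 H10 bH1] := holder_bound T0 Yh.
have [H2 H20 bH2] := holder_bound T0 Yrem.
exists (Num.max H1 H2) => [|H]; first by rewrite le_max H10.
rewrite ge_max => /andP[H1H H2H].
have Yinc s t : 0 <= s -> s < t -> t <= T ->
    `|incr Y s t| <= H * (t - s) `^ alpha.
  move=> s0 st tT; rewrite (le_trans (bH1 s t s0 st tT))//.
  by rewrite ler_wpM2r ?powR_ge0.
split => //.
- move=> t; rewrite le_eqVlt => /predU1P[<- _|t0 tT].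
    by rewrite Y0 lerDl mulr_ge0 ?powR_ge0// (le_trans H10).
  have -> : Y t = Y 0 + incr Y 0 t by rewrite /incr addrC subrK.
  rewrite Y0 (le_trans (ler_normD _ _))// lerD2l.
  rewrite (le_trans (Yinc 0 t (lexx 0) t0 tT))// subr0.
  rewrite ler_wpM2l ?(le_trans H10)// ge0_ler_powR ?nnegrE ?(ltW alpha0)//; lra.
- move=> s t s0 st tT; rewrite (le_trans (bH2 s t s0 st tT))//.
  by rewrite ler_wpM2r ?powR_ge0.
move=> t t0 tT; have [|I Iint ->] := Yint t.
  by rewrite in_itv/= t0.
by rewrite Y0 addrC addKr.
Qed.

End SolutionBounds.

Theorem theorem4p3 (R : realType) (V : completeNormedModType R)
    (sepV : separable V)
    (alpha : R) (alpha_gt : 1 / 3 < alpha) (alpha_le : alpha <= 1 / 2)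
    (T : R) (T_gt0 : 0 < T)
    (beta : 'I_4 -> R) (beta_ge0 : forall k, 0 <= beta k)
    (W : R -> V -> V) (WW : R -> R -> V -> V -> V)
    (W_rough : nl_rough_path T alpha beta W WW)
    (xi : V) (Y Z : R -> V) :
  is_solution T alpha W WW xi Y -> is_solution T alpha W WW xi Z ->
  forall t : R, t \in `[0, T] -> Y t = Z t.
Proof.
move=> Ysol Zsol t; rewrite in_itv/= => /andP[t0 tT].
have a0 : 0 < alpha by lra.
have a3 : 1 < 3 * alpha by lra.
have [HY HY0 Yr] := solution_is_rough_solution T_gt0 a0 Ysol.
have [HZ HZ0 Zr] := solution_is_rough_solution T_gt0 a0 Zsol.
pose H := Num.max HY HZ.
pose r := `|xi| + H * T `^ alpha.
have [Wfield WWfield chenW] := W_rough.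
have [L1 L10 bW] := field_ball_bound T_gt0 r Wfield.
have [L2 L20 bWW] := field2_ball_bound T_gt0 (2 * r) WWfield.
pose L := Num.max L1 L2.
have H0 : 0 <= H by rewrite le_max HY0.
have L0 : 0 <= L by rewrite le_max L10.
have {}Yr := Yr H (ltac:(by rewrite le_max lexx)).
have {}Zr := Zr H (ltac:(by rewrite le_max lexx orbT)).
have [_ Y0 _ _] := Ysol; have [_ Z0 _ _] := Zsol.
(* On [[0, T]] a solution moves away from [xi] by at most [H T^alpha], whence [r];
   the second-level field lives on pairs, whose norm is at most [2 r]. *)
apply: (rough_solution_unique a0 L0 H0 _ _ _ _ chenW a3 Yr Zr _ t0 tT).
- move=> s u s0 su uT; apply: differentiable_Dn_sub; apply: Wfield.1;
  rewrite in_itv/=; lra.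
- move=> k s u x k3 s0 su uT xr; rewrite (le_trans (bW k s u x k3 s0 su uT xr))//.
  by rewrite ler_wpM2r ?powR_ge0// le_max lexx.
- move=> s u s0 su uT; apply: (WWfield.1 s u _ _).1; rewrite in_itv/=; lra.
- move=> k s u x k3 s0 su uT xr; rewrite (le_trans (bWW k s u x k3 s0 su uT xr))//.
  by rewrite ler_wpM2r ?powR_ge0// le_max lexx orbT.
by rewrite Y0 Z0.
Qed.
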